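(* Let $D=(D_1,\dots,D_L)$ be a sequence of real numbers and let $1\le i,j\le L$. Assume $a\in B(i)\cap B(j)$ and let $b\ge a$. Then $b\in B(i)$ if and only if $b\in B(j)$.
   Context: For a sequence $F$ of reals and $1\le s\le t\le |F|$ write $\bar F(s,t)$ for the average of $F_s,\dots,F_t$. An index $1\le k\le |F|$ is a border of $F$ if there is a (possibly empty) sequence $E$ such that, with $G$ the concatenation of $F$ and $E$, $\bar G(k,|G|)=\max_{1\le s\le |G|}\bar G(s,|G|)$. For $1\le i\le L$, $B(i)$ denotes the set of indices $b$ with $i\le b\le L$ such that $b-i+1$ is a border of the sequence $(D_i,\dots,D_L)$ (i.e. the borders of $D[i,L]$ expressed as indices of $D$). *)

(* Defs.v *)
From mathcomp Require Import all_boot all_order all_algebra.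
From mathcomp Require Import classical_sets reals.

Set Implicit Arguments.
Unset Strict Implicit.
Unset Printing Implicit Defensive.

Import Order.TTheory GRing.Theory Num.Theory.

Local Open Scope ring_scope.
Local Open Scope classical_set_scope.

(* Indices into sequences are 1-based: the s-th term of F is F`_s.-1. *)

Definition average (R : realType) (F : seq R) (s t : nat) : R :=
  (\sum_(s <= k < t.+1) F`_k.-1) / (t.+1 - s)%:R.

(* The index range 1..size G is nonempty where this is used, so the default
   value of the iterated maximum is itself one of the averages. *)
Definition max_suffix_average (R : realType) (G : seq R) : R :=
  \big[Num.max/average G 1 (size G)]_(1 <= s < (size G).+1)
     average G s (size G).

Definition border (R : realType) (F : seq R) (k : nat) : Prop :=
  (1 <= k <= size F)%N /\
  exists E : seq R,
    let G := F ++ E in average G k (size G) = max_suffix_average G.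

(* drop i.-1 D is (D_i, ..., D_L) with L = size D, for 1 <= i <= L. *)
Definition B (R : realType) (D : seq R) (i : nat) : set nat :=
  [set b | (i <= b <= size D)%N /\ border (drop i.-1 D) (b - i + 1)].

(* Main.v *)
Require Import Defs.
From mathcomp Require Import all_boot all_order all_algebra.
From mathcomp Require Import classical_sets reals.
From mathcomp Require Import zify lra.

(** An index [b] lies in [B D i] when, for a suitable extension of [D] and [m]
    the average of the extended sequence from [b] on, sums from any [s >= i]
    up to [b - 1] average at most [m], and sums from [b] up to any later index
    average at least [m].  Raising [i] to some [j <= b] preserves this.
    Conversely let [i < j <= a < b], let [m] be this average for [a] (valid from
    [i]) and [m'] the one for [b] (valid from [j]): the average of
    [D_a, ..., D_(b-1)] is at least [m] and at most [m'], so [m <= m'], and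
    the bound by [m] on averages from [s < j] up to [a - 1] extends to a bound
    by [m'] on averages from [s] up to [b - 1].  So the extension witnessing
    [b] for [j] also witnesses it for [i]. *)

Import Order.TTheory GRing.Theory Num.Theory.

Local Open Scope ring_scope.
Local Open Scope classical_set_scope.

Lemma average_leE (R : realType) (G : seq R) (s n : nat) (m : R) :
  (s <= n)%N ->
  (average G s n <= m) = (\sum_(s <= k < n.+1) G`_k.-1 <= m * (n.+1 - s)%:R).
Proof. by move=> sn; rewrite /average ler_pdivrMr // ltr0n subn_gt0. Qed.

Lemma average_sumE (R : realType) (G : seq R) (s n : nat) :
  (s <= n)%N ->
  \sum_(s <= k < n.+1) G`_k.-1 = average G s n * (n.+1 - s)%:R.
Proof. by move=> sn; rewrite divfK // pnatr_eq0 subn_eq0 -ltnNge. Qed.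

(** The average from [s] is a weighted mean of the average over [s..b-1] and the average from [b],
    so it is at most the latter exactly when the first block is. *)
Lemma average_le_before (R : realType) (G : seq R) (s b n : nat) :
  (s <= b <= n)%N ->
  (average G s n <= average G b n) =
  (\sum_(s <= k < b) G`_k.-1 <= average G b n * (b - s)%:R).
Proof.
move=> /andP[sb bn]; rewrite average_leE ?(leq_trans sb) //.
rewrite (big_cat_nat sb (leqW bn)) /= average_sumE //.
have -> : (n.+1 - s = (b - s) + (n.+1 - b))%N by lia.
by rewrite natrD mulrDr lerD2r.
Qed.

(** Here the average from [b] is the weighted mean: the tail from [s] lies at or below it exactly
    when the block [b..s-1] lies at or above it. *)
Lemma average_le_after (R : realType) (G : seq R) (b s n : nat) :
  (b <= s <= n)%N ->
  (average G s n <= average G b n) =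
  (average G b n * (s - b)%:R <= \sum_(b <= k < s) G`_k.-1).
Proof.
move=> /andP[bs sn]; rewrite average_leE //.
have := average_sumE _ G _ _ (leq_trans bs sn).
rewrite (big_cat_nat bs (leqW sn)) /=.
have -> : (n.+1 - b = (s - b) + (n.+1 - s))%N by lia.
rewrite natrD mulrDr => e.
by apply/idP/idP => h; lra.
Qed.

Lemma max_suffix_averageP (R : realType) (G : seq R) (k : nat) :
  (1 <= k <= size G)%N ->
  average G k (size G) = max_suffix_average G <->
  (forall s, (1 <= s <= size G)%N ->
     average G s (size G) <= average G k (size G)).
Proof.
move=> hk; rewrite /max_suffix_average; split => [-> s hs|h].
  by apply: (@bigmax_sup_seq _ _ _ _ _ s) => //; rewrite mem_index_iota.
apply/le_anti/andP; split.
  by apply: (@bigmax_sup_seq _ _ _ _ _ k) => //; rewrite mem_index_iota.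
(* The default value of the maximum is the average at [s = 1], so [h] bounds it too. *)
by rewrite big_nat; apply: bigmax_le => [|s hs]; apply: h; lia.
Qed.

Lemma average_drop (R : realType) (G : seq R) (d s t : nat) :
  (1 <= s)%N -> average (drop d G) s t = average G (s + d) (t + d).
Proof.
move=> s1; rewrite /average -addSn subnDr big_addn addnK; congr (_ / _).
apply: eq_big_nat => k hk; rewrite nth_drop; by congr nth; lia.
Qed.

(** This makes bounds obtained from two different extensions of [D] comparable. *)
Lemma sum_nth_cat (R : realType) (D E : seq R) (s t : nat) :
  (1 <= s)%N -> (t <= (size D).+1)%N ->
  \sum_(s <= k < t) (D ++ E)`_k.-1 = \sum_(s <= k < t) D`_k.-1.
Proof.
move=> s1 tD; apply: eq_big_nat => k hk.
have kD : (k.-1 < size D)%N by lia.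
by rewrite nth_cat kD.
Qed.

(** Averages of suffixes starting at or after [i] ignore the terms before [i], so an extension of
    the dropped sequence serves as an extension of [D] itself, with no index shift. *)
Lemma mem_B (R : realType) (D : seq R) (i b : nat) :
  (1 <= i <= size D)%N ->
  B D i b <->
  (i <= b <= size D)%N /\
  exists E : seq R, forall s, (i <= s <= size (D ++ E))%N ->
    average (D ++ E) s (size (D ++ E)) <= average (D ++ E) b (size (D ++ E)).
Proof.
move=> hi.
have dropE E : drop i.-1 D ++ E = drop i.-1 (D ++ E).
  by rewrite drop_cat ifT //; lia.
have szE E : (size (drop i.-1 (D ++ E)) + i.-1 = size (D ++ E))%N.
  by rewrite size_drop size_cat; lia.
have key E : (i <= b <= size D)%N ->
    average (drop i.-1 D ++ E) (b - i + 1) (size (drop i.-1 D ++ E)) =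
      max_suffix_average (drop i.-1 D ++ E) <->
    forall s, (i <= s <= size (D ++ E))%N ->
    average (D ++ E) s (size (D ++ E)) <= average (D ++ E) b (size (D ++ E)).
  move=> hb; rewrite dropE.
  have szD := szE E; have szc := size_cat D E.
  rewrite max_suffix_averageP; last by lia.
  have be : (b - i + 1 + i.-1 = b)%N by lia.
  split=> h s hs.
    have := h (s - i.-1)%N; rewrite !average_drop; try lia.
    rewrite szD be subnK; last by lia.
    by apply; lia.
  rewrite !average_drop; try lia.
  by rewrite szD be; apply: h; lia.
split=> [[hb [_ [E /= hE]]]|[hb [E hE]]]; split=> //.
  by exists E; apply/key.
split; first by rewrite size_drop; lia.
by exists E; apply/key.
Qed.

Lemma B_later_start (R : realType) (D : seq R) (i j b : nat) :
  (1 <= i <= j)%N -> (j <= b)%N -> B D i b -> B D j b.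
Proof.
move=> hij jb hB; have [hb _] := hB.
have hi : (1 <= i <= size D)%N by lia.
have hj : (1 <= j <= size D)%N by lia.
have [_ [E hE]] := (mem_B _ _ _ _ hi).1 hB.
apply/(mem_B _ _ _ _ hj); split; first by lia.
by exists E => s hs; apply: hE; lia.
Qed.

Lemma B_earlier_start (R : realType) (D : seq R) (i j a b : nat) :
  (1 <= i <= j)%N -> (j <= a <= b)%N -> B D i a -> B D j b -> B D i b.
Proof.
(* The case [a = b] is settled by [hBa]; otherwise [b - a] is positive and can be cancelled to get
   [m <= m']. *)
move=> hij /andP[ja]; rewrite leq_eqVlt => /orP[/eqP <- //|ab] hBa hBb.
have [hb _] := hBb.
have hi : (1 <= i <= size D)%N by lia.
have hj : (1 <= j <= size D)%N by lia.
have [_ [E]] := (mem_B _ _ _ _ hi).1 hBa.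
have [_ [E']] := (mem_B _ _ _ _ hj).1 hBb.
have szc := size_cat D E; have szc' := size_cat D E'.
set n' := size (D ++ E') in szc' *; set n := size (D ++ E) in szc *.
set m' := average (D ++ E') b n'; set m := average (D ++ E) a n.
move=> hb' ha'.
have hm' : \sum_(a <= k < b) D`_k.-1 <= m' * (b - a)%:R.
  by have := hb' a; rewrite /m' average_le_before ?sum_nth_cat; lia.
have hm : m * (b - a)%:R <= \sum_(a <= k < b) D`_k.-1.
  by have := ha' b; rewrite /m average_le_after ?sum_nth_cat; lia.
have mm' : m <= m'.
  by rewrite -(ler_pM2r (_ : 0 < (b - a)%:R)) ?ltr0n ?subn_gt0 // (le_trans hm).
apply/(mem_B _ _ _ _ hi); split; first by lia.
(* Only starts [s < j] are new; they satisfy [s <= a], so the block [s..b-1] splits at [a]. *)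
exists E' => s hs; have [sj|js] := ltnP s j; last by apply: hb'; lia.
rewrite average_le_before -/n' -/m' ?sum_nth_cat; try lia.
have sa : (s <= a)%N by lia.
have hs' : \sum_(s <= k < a) D`_k.-1 <= m * (a - s)%:R.
  by have := ha' s; rewrite /m average_le_before ?sum_nth_cat; lia.
rewrite (big_cat_nat sa (ltnW ab)) /=.
have -> : (b - s = (a - s) + (b - a))%N by lia.
by rewrite natrD mulrDr lerD // (le_trans hs') // ler_wpM2r.
Qed.

Theorem theorem6 (R : realType) (D : seq R) (i j a b : nat)
  (hi : (1 <= i <= size D)%N) (hj : (1 <= j <= size D)%N)
  (ha : (B D i `&` B D j) a) (hab : (a <= b)%N) :
  B D i b <-> B D j b.
Proof.
have [hai haj] := ha; have [ia _] := hai; have [ja _] := haj.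
have [ij|ji] := leqP i j.
  split; first by apply: B_later_start; lia.
  by apply: (@B_earlier_start _ _ _ _ a) => //; lia.
split; last by apply: B_later_start; lia.
by apply: (@B_earlier_start _ _ _ _ a) => //; lia.
Qed.
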